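(* Let $\Omega\subset\mathbb{R}$ be a nonempty bounded open set, written as $\Omega=\bigcup_{n\in I}\,]a_n,b_n[$ with pairwise disjoint open intervals $]a_n,b_n[$, where $I=\mathbb{N}$ or $I=\{1,\dots,k\}$, and let $L=\max_{n\in I}(b_n-a_n)$. Let $f:[0,\infty[\to[0,\infty[$ be an increasing continuous function with $\lim_{s\to\infty}f(s)=\infty$ and $f(0)>0$. Consider, for $\lambda>0$, the problem $$-\left(\frac{u'}{|u'|}\right)'=\lambda f(u)\ \text{ in }\Omega,\qquad u=0\ \text{ on }\partial\Omega .$$ Set $\lambda^*=\frac{2}{Lf(0)}$. Then: (1) If $\lambda>\lambda^*$, the problem has no solution. (2) If $0<\lambda\le\lambda^*$, the trivial solution $u\equiv0$ is the minimal solution to the problem.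
   Context: ''Increasing'' means strictly increasing. The intervals $]a_n,b_n[$ are the connected components of $\Omega$. Since $f$ is defined on $[0,\infty[$, solutions are nonnegative functions. $BV(\Omega)$ is the space of $u\in L^1(\Omega)$ whose distributional derivative $u'=Du$ is a bounded Radon measure. $L^{1,\infty}(\Omega)$ is the space of measurable $g$ such that $k\,|\{|g|>k\}|\le C$ for all $k>0$, with $C$ independent of $k$. A function $u\in BV(\Omega)$ is a solution if $f(u)\in L^{1,\infty}(\Omega)$ and there is $\mathbf z\in L^\infty(\Omega)$ (the function associated with $u$) such that: (i) $\|\mathbf z\|_\infty\le1$; (ii) $-\mathbf z'=\lambda f(u)$ in $\mathcal D'(\Omega)$; (iii) $(\mathbf z,Du)=|Du|$ as measures in $\Omega$, where $(\mathbf z,Du)$ is the distribution $\langle(\mathbf z,Du),\varphi\rangle=-\int_\Omega u\varphi\,\mathbf z'-\int_\Omega u\,\mathbf z\,\varphi'$, $\varphi\in C_c^\infty(\Omega)$; (iv) $[\mathbf z,\nu]\in\operatorname{sign}(-u)$ on $\partial\Omega$, that is, at the endpoints of each component interval, with one-sided traces of $u$ and $\mathbf z$ taken from inside the interval and outward normal $\nu=-1$ at $a_n$, $\nu=+1$ at $b_n$. Here $\operatorname{sign}$ is the multivalued sign: $\operatorname{sign}(s)=\{s/|s|\}$ for $s\ne0$ and $\operatorname{sign}(0)=[-1,1]$. A minimal solution is a solution which is less than or equal to every other (nonnegative) solution. *)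

(* Defs.v *)
From HB Require Import structures.
From mathcomp Require Import all_boot all_order all_algebra.
From mathcomp Require Import all_classical all_reals all_analysis.

Set Implicit Arguments.
Unset Strict Implicit.
Unset Printing Implicit Defensive.

Import Order.TTheory GRing.Theory Num.Theory.
Import numFieldNormedType.Exports.

Local Open Scope classical_set_scope.
Local Open Scope ring_scope.

Section Problem.
Context {R : realType}.
Implicit Types (Omega : set R) (u v z dz g f phi : R -> R) (s l : R).

Local Notation mu := (@lebesgue_measure R).

(* Only the values on Omega of the functions u, v, z, g below matter. *)

Definition smooth phi := forall (n : nat) x, derivable (derive1n n phi) x 1.

(* phi \in C_c^\infty(Omega) *)
Definition test_function Omega phi :=
  [/\ smooth phi, compact (closure [set x | phi x != 0])
    & closure [set x | phi x != 0] `<=` Omega].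

(* z' = g in D'(Omega), for a function g (which, to define a distribution,
   has to be locally integrable) *)
Definition weak_derivative Omega z g :=
  [/\ locally_integrable Omega z, locally_integrable Omega g &
    forall phi, test_function Omega phi ->
      - (\int[mu]_(x in Omega) (z x * derive1 phi x)) =
      (\int[mu]_(x in Omega) (g x * phi x))].

(* The bounded signed Radon measures on Omega are represented by the charges
   (i.e. the finite signed Borel measures) on R that vanish outside Omega. *)
Definition concentrated_on Omega
    (nu : {charge set (measurableTypeR R) -> \bar R}) :=
  forall A : set (measurableTypeR R),
    measurable A -> A `&` Omega = set0 -> nu A = 0%E.

(* u \in BV(Omega) with u' = Du. The measure Du comes with a Hahn decomposition
   (P, N); the Jordan decomposition it defines does not depend on its choice. *)
Definition BV_with_derivative Omega u
    (Du : {charge set (measurableTypeR R) -> \bar R})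
    (P N : set (measurableTypeR R)) (PN : hahn_decomposition Du P N) :=
  [/\ mu.-integrable Omega (EFin \o u), concentrated_on Omega Du &
    forall phi, test_function Omega phi ->
      - (\int[mu]_(x in Omega) (u x * derive1 phi x)) =
      (\int[jordan_pos PN]_(x in Omega) phi x) -
      (\int[jordan_neg PN]_(x in Omega) phi x)].

(* g \in L^{1,\infty}(Omega) *)
Definition weak_L1 Omega g :=
  measurable_fun Omega g /\
  exists C : R, forall k : R, 0 < k ->
    (k%:E * mu (Omega `&` [set x | (k < `|g x|)%R]) <= C%:E)%E.

(* The distribution (z, Du), where dz is the function z' *)
Definition pairing Omega u z (dz : R -> R) phi : R :=
  - (\int[mu]_(x in Omega) (u x * phi x * dz x))
  - (\int[mu]_(x in Omega) (u x * z x * derive1 phi x)).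

(* One-sided traces v(a+) = t and v(b-) = t, as essential limits since v is
   only given up to a null set *)
Definition right_trace v (a t : R) :=
  forall e : R, 0 < e -> exists2 d : R, 0 < d &
    {ae mu, forall x, a < x < a + d -> `|v x - t| <= e}.

Definition left_trace v (b t : R) :=
  forall e : R, 0 < e -> exists2 d : R, 0 < d &
    {ae mu, forall x, b - d < x < b -> `|v x - t| <= e}.

Definition multisign s : set R :=
  if s == 0 then `[-1, 1]%classic else [set s / `|s|].

(* [z, nu] \in sign (- u) at the endpoints of ]a, b[: the outward normal nu is
   -1 at a and 1 at b *)
Definition boundary_condition u z (a b : R) :=
  (exists ua za, [/\ right_trace u a ua, right_trace z a za &
     multisign (- ua) (za * -1)]) /\
  (exists ub zb, [/\ left_trace u b ub, left_trace z b zb &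
     multisign (- ub) (zb * 1)]).

(* The nonnegative representatives of the solutions, on the open set Omega whose
   connected components are the ]a n, b n[, n \in I. Nonnegativity is required
   everywhere because f is only meaningful on [0, +oo[. *)
Definition is_solution Omega (I : set nat) (a b : nat -> R) f l u :=
  [/\ forall x, Omega x -> 0 <= u x,
      weak_L1 Omega (f \o u) &
      exists (Du : {charge set (measurableTypeR R) -> \bar R})
             (P N : set (measurableTypeR R))
             (PN : hahn_decomposition Du P N) (z : R -> R),
        let dz := fun x => - (l * f (u x)) in
        [/\ BV_with_derivative Omega u PN,
            measurable_fun Omega z /\
              {ae mu, forall x, Omega x -> `|z x| <= 1},
            weak_derivative Omega z dz,
            forall phi, test_function Omega phi ->
              pairing Omega u z dz phi =
              (\int[charge_variation PN]_(x in Omega) phi x) &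
            forall n, I n -> boundary_condition u z (a n) (b n)]].

Definition is_minimal_solution Omega (I : set nat) (a b : nat -> R) f l u :=
  is_solution Omega I a b f l u /\
  forall v, is_solution Omega I a b f l v ->
    {ae mu, forall x, Omega x -> u x <= v x}.

End Problem.

(* Main.v *)
Require Import Defs.
From HB Require Import structures.
From mathcomp Require Import all_boot all_order all_algebra.
From mathcomp Require Import all_classical all_reals all_analysis.
From mathcomp Require Import measurable_realfun lra ring.

(* Let c = lambda f(0). If u is a solution, then - z' = lambda f(u) >= c on a
   longest component ]a, b[, while |z| <= 1; testing this inequality against
   smooth cutoff functions phi that increase from 0 to about 1 and decrease back
   to 0, so that the L^1 norm of phi' is at most 2, and letting phi tend to the
   indicator of ]a, b[ yields c L <= 2. Conversely, if c L <= 2, then u = 0 is a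
   solution: its associated z is, on each component, the affine function of
   slope - c that vanishes at the midpoint. Minimality of 0 is clear since
   solutions are nonnegative. *)

Set Implicit Arguments.
Unset Strict Implicit.
Unset Printing Implicit Defensive.

Import Order.TTheory GRing.Theory Num.Theory.
Import numFieldNormedType.Exports.

Local Open Scope classical_set_scope.
Local Open Scope ring_scope.

(** * Smooth functions: stability under products and affine substitutions, and functions flat at
    0 *)

Section Smooth.
Context {R : realType}.
Implicit Types (f g phi : R -> R) (p : {poly R}) (t : R).

(** A finite-order form of [smooth], which allows induction on the order with the function
    generalised: the derivative of a product is a sum of products of functions that are
    differentiable one time less. *)
Definition derivable_upto n f :=
  forall k x, (k < n)%N -> derivable (derive1n k f) x 1.

Lemma derivable_uptoS n f :
  derivable_upto n.+1 f <->
  (forall x, derivable f x 1) /\ derivable_upto n (derive1 f).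
Proof.
split=> [df|[df df'] [|k] x kn].
- split=> [x|k x kn]; first exact: (df 0%N).
  by rewrite -derive1Sn; exact: df.
- exact: df.
- by rewrite derive1Sn; exact: df'.
Qed.

Lemma derivable_uptoW n f : derivable_upto n.+1 f -> derivable_upto n f.
Proof. by move=> df k x kn; apply: df; rewrite ltnS ltnW. Qed.

Lemma derivable_uptoD n f g :
  derivable_upto n f -> derivable_upto n g -> derivable_upto n (f + g).
Proof.
elim: n f g => [|n IH] f g; first by move=> _ _ k x; rewrite ltn0.
move=> /derivable_uptoS[df df'] /derivable_uptoS[dg dg'].
apply/derivable_uptoS; split=> [x|]; first exact: derivableD.
suff -> : derive1 (f + g) = derive1 f + derive1 g by exact: IH.
by apply/funext => x; rewrite !fctE !derive1E (deriveD (df x) (dg x)).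
Qed.

Lemma derivable_uptoM n f g :
  derivable_upto n f -> derivable_upto n g -> derivable_upto n (f * g).
Proof.
elim: n f g => [|n IH] f g; first by move=> _ _ k x; rewrite ltn0.
move=> df dg.
have [df0 df'] := (derivable_uptoS _ _).1 df.
have [dg0 dg'] := (derivable_uptoS _ _).1 dg.
apply/derivable_uptoS; split=> [x|]; first exact: derivableM.
have -> : derive1 (f * g) = f * derive1 g + g * derive1 f.
  by apply/funext => x; rewrite !fctE !derive1E (deriveM (df0 x) (dg0 x)).
apply: derivable_uptoD.
  by apply: (IH _ _ _ dg'); exact: derivable_uptoW.
by apply: (IH _ _ _ df'); exact: derivable_uptoW.
Qed.

Lemma smoothP phi : smooth phi <-> forall n, derivable_upto n phi.
Proof.
split=> [sphi n k x _|sphi n x]; first exact: sphi.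
exact: (sphi n.+1 n x (ltnSn n)).
Qed.

Lemma smoothM f g : smooth f -> smooth g -> smooth (f * g).
Proof.
by move=> /smoothP sf /smoothP sg; apply/smoothP => n; exact: derivable_uptoM.
Qed.

Lemma smooth_continuous phi n :
  smooth phi -> continuous (derive1n n phi).
Proof.
by move=> sphi x; apply/differentiable_continuous/derivable1_diffP; exact: sphi.
Qed.

Lemma is_derive_comp_affine f (k m x : R) :
  derivable f (k * x + m) 1 ->
  is_derive x 1 (fun y => f (k * y + m)) (k * derive1 f (k * x + m)).
Proof.
move=> df.
have daff : is_derive x 1 (fun y : R => k * y + m) k.
  have := is_deriveD (is_deriveZ k (is_derive_id x 1)) (is_derive_cst m x 1).
  by move=> /is_derive_eq; apply; rewrite addr0 /GRing.scale/= mulr1.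
have := @is_derive1_comp _ f _ x _ _ (derivableP df) daff.
by rewrite mulrC -derive1E.
Qed.

Lemma smooth_comp_affine f (k m : R) :
  smooth f -> smooth (fun x => f (k * x + m)).
Proof.
move=> sf n.
suff -> : derive1n n (fun x => f (k * x + m)) =
    fun x => k ^+ n * derive1n n f (k * x + m).
  move=> x; apply: derivableM; first exact: derivable_cst.
  by have [] := is_derive_comp_affine (sf n (k * x + m)).
elim: n => [|n IH]; first by apply/funext => x; rewrite expr0 mul1r.
rewrite derive1nS IH; apply/funext => x.
have dn := is_derive_comp_affine (sf n (k * x + m)).
have [_ dE] := @is_deriveZ _ _ _ _ (k ^+ n) _ _ _ dn.
by rewrite derive1E; apply: etrans dE _; rewrite /GRing.scale/= exprSr mulrA.
Qed.

(* The derivative of p(1/t) exp(-1/t) is q(1/t) exp(-1/t) with q = X^2 (p - p'),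
   so this family of functions is closed under derivation. *)
Definition flat p (t : R) := if 0 < t then p.[t^-1] * expR (- t^-1) else 0.

(** For t > 0, the exponential series gives exp(1/t) >= t^-(i+1) / (i+1)!, so each monomial
    satisfies t^-i exp(-1/t) <= (i+1)! t. This linear bound yields differentiability at 0. *)
Lemma flat_le p : exists2 C : R, 0 <= C & forall t, `|flat p t| <= C * `|t|.
Proof.
exists (\sum_(i < size p) `|p`_i| * i.+1`!%:R).
  by apply: sumr_ge0 => i _; rewrite mulr_ge0.
move=> t; rewrite /flat; case: ifPn => [t0|_]; last first.
  by rewrite normr0 mulr_ge0// sumr_ge0// => i _; rewrite mulr_ge0.
rewrite normrM (ger0_norm (expR_ge0 _)) horner_coef.
apply: (@le_trans _ _
  ((\sum_(i < size p) `|p`_i| * t^-1 ^+ i) * expR (- t^-1))).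
  rewrite ler_wpM2r ?expR_ge0//; apply: (le_trans (ler_norm_sum _ _ _)).
  apply: ler_sum => i _.
  by rewrite normrM (ger0_norm (exprn_ge0 _ _))// invr_ge0 ltW.
rewrite (gtr0_norm t0) !mulr_suml ler_sum// => i _.
rewrite -!mulrA ler_wpM2l// expRN ler_pdivrMr ?expR_gt0//.
rewrite -ler_pdivrMl ?mulr_gt0 ?ltr0n ?fact_gt0//.
have := @expR_ge1Dxn _ t^-1 i; rewrite invr_ge0 (ltW t0) => /(_ isT).
apply: le_trans; rewrite -[leLHS]add0r lerD//.
by rewrite invfM exprS le_eqVlt; apply/orP/or_introl/eqP; ring.
Qed.

Lemma is_derive_flat p (t : R) :
  is_derive t 1 (flat p) (flat ('X ^+ 2 * (p - p^`())) t).
Proof.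
rewrite {2}/flat; case: ifPn => [t0|].
  2: rewrite -leNgt le_eqVlt => /predU1P[->|t0].
- apply: (@near_eq_is_derive _ _ _
    ((horner p \o GRing.inv) * (expR \o -%R \o GRing.inv))).
    apply: filterS (lt_nbhsr t0) => x x0.
    by rewrite /flat x0 !fctE.
  have dinv : is_derive t (1 : R) GRing.inv (- t ^- 2).
    have := @is_deriveV _ id t 1 1; rewrite gt_eqF// => /(_ isT _).
    by rewrite /GRing.scale/= mulr1; exact.
  have dp := is_derive1_comp (is_derive_poly p t^-1) dinv.
  have de : is_derive t^-1 (1 : R) (expR \o -%R) (expR (- t^-1) * -1).
    exact: is_derive1_comp.
  have /is_derive_eq := is_deriveM dp (is_derive1_comp de dinv); apply.
  rewrite /GRing.scale/= hornerM hornerXn hornerD hornerN -exprVn; ring.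
- have lim0 : h^-1 *: ((flat p \o shift 0) (h *: (1 : R)) - flat p 0)
      @[h --> 0^'] --> (0 : R).
    (* The difference quotient at 0 is [flat p h / h], which is [flat ('X * p) h]; it is therefore
       bounded by a multiple of |h| and tends to 0. *)
    have [C C0 HC] := flat_le ('X * p).
    apply: norm_cvg0.
    apply: (@squeeze_cvgr _ _ _ _ (fun=> 0) (fun h => C * `|h|)).
    + near=> h; rewrite normr_ge0/=; apply: le_trans (HC h).
      rewrite /flat ltxx subr0 /= addr0 /GRing.scale/= mulr1.
      case: ifP => _; last by rewrite mulr0.
      by rewrite hornerM hornerX mulrA.
    + exact: cvg_cst.
    + rewrite -[X in _ --> X](mulr0 C); apply: cvgM; first exact: cvg_cst.
      apply: cvg_within_filter.
      have := @cvg_norm _ R _ (nbhs (0 : R)) _ id 0 cvg_id.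
      by rewrite normr0; exact.
  by apply: DeriveDef; [apply: cvgP lim0|exact: cvg_lim lim0].
- apply: (@near_eq_is_derive _ _ _ (cst 0)).
    apply: filterS (lt_nbhsl t0) => x x0.
    by rewrite /flat ltNge (ltW x0).
Unshelve. all: by end_near. Qed.

Lemma smooth_flat p : smooth (flat p).
Proof.
move=> n.
suff [q ->] : exists q, derive1n n (flat p) = flat q.
  by move=> x; have [] := is_derive_flat q x.
elim: n => [|n [q qE]]; first by exists p.
exists ('X ^+ 2 * (q - q^`())); rewrite derive1nS qE.
by apply/funext => x; rewrite derive1E; have [] := is_derive_flat q x.
Qed.

End Smooth.

(** * Smooth cutoff functions on an interval, with control of the derivative *)

Section Cutoff.
Context {R : realType}.
Local Notation mu := (@lebesgue_measure R).

(** The classical function exp(-1/t), extended by 0 to t <= 0. *)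
Let E : R -> R := flat 1.

Let E_ge0 (t : R) : 0 <= E t.
Proof.
by rewrite /E /flat; case: ifP => // _; rewrite hornerC mul1r expR_ge0.
Qed.

Let E_eq0 (t : R) : t <= 0 -> E t = 0.
Proof. by move=> t0; rewrite /E /flat ltNge t0. Qed.

Let E_le1 (t : R) : E t <= 1.
Proof.
rewrite /E /flat; case: ifPn => // t0; rewrite hornerC mul1r.
by rewrite -expR0 ler_expR oppr_le0 invr_ge0 ltW.
Qed.

Let E_ge (t : R) : 0 < t -> 1 - t^-1 <= E t.
Proof. by move=> t0; rewrite /E /flat t0 hornerC mul1r expR_ge1Dx. Qed.

Let derive1_E_ge0 (t : R) : 0 <= derive1 E t.
Proof.
rewrite derive1E; have [_ ->] := is_derive_flat (1 : {poly R}) t.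
rewrite /flat; case: ifP => // _.
rewrite -polyC1 derivC subr0 mulr1 hornerXn.
by rewrite mulr_ge0 ?expR_ge0 ?sqr_ge0.
Qed.

(** [phi] is the product of a rising and a falling rescaled copy of exp(-1/t). The bound 2 accounts
    for one rise and one fall, each of height at most 1. The majorant [w] is a derivative, so its
    integral is computed by the fundamental theorem of calculus. *)
Lemma cutoff (a b d : R) : 0 < d -> 4 * d < b - a ->
  exists phi w : R -> R, [/\ smooth phi,
    (forall x, 0 <= phi x),
    (forall x : R, phi x != 0 -> a + d <= x <= b - d),
    (forall x : R, a + 2 * d <= x <= b - 2 * d -> 1 - 2 * d <= phi x) &
    [/\ continuous w, (forall x, `|derive1 phi x| <= w x) &
      (\int[mu]_(x in `[(a + d)%R, (b - d)%R]) (w x)%:E <= 2%:E)%E]].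
Proof.
move=> d0 dab.
have d2 : 0 < d ^- 2 by rewrite invr_gt0 exprn_gt0.
(* The factor d^-2 makes the argument of [E] at least 1/d at distance d inside the support, where
   [E] is then at least 1 - d. *)
pose F (x : R) := E (d ^- 2 * x + - (d ^- 2 * (a + d))).
pose G (x : R) := E (- d ^- 2 * x + d ^- 2 * (b - d)).
have sE : smooth E by exact: smooth_flat.
have sF : smooth F by exact: smooth_comp_affine.
have sG : smooth G by exact: smooth_comp_affine.
have dF (x : R) : is_derive x 1 F (derive1 F x).
  by rewrite derive1E; apply: derivableP; exact: (sF 0%N).
have dG (x : R) : is_derive x 1 G (derive1 G x).
  by rewrite derive1E; apply: derivableP; exact: (sG 0%N).
have F'_ge0 x : 0 <= derive1 F x.
  rewrite derive1E.
  have [_ dE] :=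
    is_derive_comp_affine (sE 0%N (d ^- 2 * x + - (d ^- 2 * (a + d)))).
  by rewrite [leRHS]dE mulr_ge0// ltW.
have G'_le0 x : derive1 G x <= 0.
  rewrite derive1E.
  have [_ dE] :=
    is_derive_comp_affine (sE 0%N (- d ^- 2 * x + d ^- 2 * (b - d))).
  by rewrite [leLHS]dE mulr_le0_ge0// oppr_le0 ltW.
have FE x : F x = E (d ^- 2 * (x - (a + d))) by rewrite /F -mulrBr.
have GE x : G x = E (d ^- 2 * (b - d - x)).
  by rewrite /G mulNr addrC -mulrBr.
have dH (x : R) : is_derive x 1 (F - G) (derive1 F x - derive1 G x).
  exact: is_deriveB.
have cH' : continuous (derive1 F - derive1 G).
  move=> x; apply: continuousB.
    exact: (@smooth_continuous _ F 1%N sF).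
  exact: (@smooth_continuous _ G 1%N sG).
(* [0 <= F, G <= 1], [F' >= 0] and [G' <= 0] give [|(F G)'| <= F' - G'], whose
   integral is [(F - G) (b - d) - (F - G) (a + d) <= 2]. *)
exists (F * G), (derive1 F - derive1 G); split.
- exact: smoothM.
- by move=> x; rewrite mulr_ge0// ?FE ?GE E_ge0.
- move=> x; rewrite !fctE mulf_eq0 negb_or FE GE => /andP[Fx Gx].
  have pos t : E (d ^- 2 * t) != 0 -> 0 <= t.
    apply: contraNT; rewrite -ltNge => t0.
    by rewrite E_eq0// mulr_ge0_le0// ltW.
  by rewrite -subr_ge0 (pos _ Fx) -subr_ge0 (pos _ Gx).
- move=> x /andP[ax xb].
  have E_ged t : d <= t -> 1 - d <= E (d ^- 2 * t).
    move=> dt; have t0 : 0 < t by exact: lt_le_trans dt.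
    apply: le_trans (E_ge _); last by rewrite mulr_gt0.
    rewrite lerD2l lerN2 invfM invrK ler_pdivrMr// expr2.
    by rewrite ler_wpM2l// ltW.
  have Fx : 1 - d <= F x by rewrite FE; apply: E_ged; lra.
  have Gx : 1 - d <= G x by rewrite GE; apply: E_ged; lra.
  have F1 : F x <= 1 by exact: E_le1.
  have G1 : G x <= 1 by exact: E_le1.
  (* From (1 - F)(1 - G) >= 0 follows F G >= F + G - 1 >= 1 - 2 d, whatever the sign of 1 - d. *)
  rewrite fctE; nra.
- split.
  + exact: cH'.
  + move=> x; rewrite derive1E; have [_ ->] := is_deriveM (dF x) (dG x).
    have F0 : 0 <= F x by exact: E_ge0.
    have G0 : 0 <= G x by exact: E_ge0.
    have F1 : F x <= 1 by exact: E_le1.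
    have G1 : G x <= 1 by exact: E_le1.
    have := F'_ge0 x; have := G'_le0 x.
    rewrite /GRing.scale/= !fctE => ? ?.
    rewrite ler_norml; apply/andP; split; nra.
  + rewrite (@continuous_FTC2 _ _ (F - G)).
    * rewrite -EFinB lee_fin !fctE.
      have -> : F (a + d) = 0 by rewrite FE subrr mulr0 E_eq0.
      have -> : G (b - d) = 0 by rewrite GE subrr mulr0 E_eq0.
      have F1 : F (b - d) <= 1 by exact: E_le1.
      have G1 : G (a + d) <= 1 by exact: E_le1.
      lra.
    * lra.
    * exact: continuous_subspaceT.
    * have cH x : {for x, continuous (F - G)}.
        by apply/differentiable_continuous/derivable1_diffP; have [] := dH x.
      split=> [x _||]; first by have [] := dH x.
        exact: cvg_at_right_filter (cH _).
      exact: cvg_at_left_filter (cH _).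
    * by move=> x _; rewrite derive1E; have [_ ->] := dH x.
Qed.

End Cutoff.

(** * The upper bound on the length of a component *)

Section NoSolution.
Context {R : realType}.
Local Notation mu := (@lebesgue_measure R).

Lemma derive1_locally_eq0 (phi : R -> R) (A : set R) x : open A -> A x ->
  (forall y, A y -> phi y = 0) -> derive1 phi x = 0.
Proof.
move=> oA Ax phi0.
rewrite derive1E (@near_eq_derive _ _ _ phi (cst 0)) ?derive_cst//.
by apply: filterS (open_nbhs_nbhs (conj oA Ax)) => y; exact: phi0.
Qed.

Lemma Rintegral_support (A K : set R) (h : R -> R) : K `<=` A ->
  (forall x, ~ K x -> h x = 0) ->
  \int[mu]_(x in A) h x = \int[mu]_(x in K) h x.
Proof.
move=> KA h0; rewrite Rintegral_mkcond [RHS]Rintegral_mkcond.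
congr Rintegral; apply/funext => x; rewrite /patch.
have [Kx|nKx] := pselect (K x); first by rewrite !mem_set//; exact: KA.
by rewrite (memNset nKx); case: ifP => // _; exact: h0.
Qed.

Lemma test_function_itv (Omega : set R) (phi : R -> R) (a b : R) : smooth phi ->
  (forall x, phi x != 0 -> a <= x <= b) -> `[a, b]%classic `<=` Omega ->
  test_function Omega phi.
Proof.
move=> sphi phi0 abO.
have supp : closure [set x | phi x != 0] `<=` `[a, b]%classic.
  rewrite [X in _ `<=` X](closure_id _).1; last exact: interval_closed.
  by apply: closure_subset => x; exact: phi0.
split=> //; last exact: subset_trans abO.
apply: subclosed_compact supp; first exact: closed_closure.
exact: segment_compact.
Qed.

(** A cutoff of parameter [d] gives the inequality up to an error that vanishes with [d]. In place
    of a limit, a violation is refuted by one explicit small [d]. *)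
Lemma weak_derivative_le_length (Omega : set R) (z g : R -> R) (a b c : R) :
  0 <= c -> a < b -> `]a, b[%classic `<=` Omega -> weak_derivative Omega z g ->
  {ae mu, forall x, Omega x -> `|z x| <= 1} ->
  (forall x, Omega x -> g x <= - c) ->
  c * (b - a) <= 2.
Proof.
move=> c0 ab abO [[mz oO _] [mg _ lg] zg] z1 gc.
have key (d : R) : 0 < d -> 4 * d < b - a ->
    c * ((1 - 2 * d) * (b - a - 4 * d)) <= 2.
  move=> d0 dab.
  have [phi [w [sphi phi_ge0 phi_supp phi_ge [cw phi'w intw]]]] :=
    cutoff d0 dab.
  set K : set R := `[a + d, b - d]%classic in intw.
  have mK : measurable K by exact: measurable_itv.
  have cK : compact K by exact: segment_compact.
  have KO : K `<=` Omega.
    apply: subset_trans abO => x; rewrite /K/= !in_itv/= => /andP[ax xb].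
    by apply/andP; split; lra.
  have phi0 x : ~ K x -> phi x = 0.
    move=> nKx; apply/eqP; apply: contra_notT nKx => /phi_supp.
    by rewrite /K/= in_itv.
  have phi'0 x : ~ K x -> derive1 phi x = 0.
    move=> nKx; apply: (@derive1_locally_eq0 _ (~` K)) => //.
    by apply: closed_openC; exact: interval_closed.
  have cphi : continuous phi by exact: (@smooth_continuous _ phi 0%N).
  have cphi' : continuous (derive1 phi).
    exact: (@smooth_continuous _ phi 1%N).
  have := zg _ (test_function_itv sphi phi_supp KO).
  rewrite (Rintegral_support KO) => [|x /phi'0 ->]; last by rewrite mulr0.
  rewrite (Rintegral_support KO) => [|x /phi0 ->]; last by rewrite mulr0.
  have mphi' : measurable_fun K (derive1 phi).
    by apply: measurable_funTS; exact: continuous_measurable_fun.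
  have mphi : measurable_fun K phi.
    by apply: measurable_funTS; exact: continuous_measurable_fun.
  have mzphi' : measurable_fun K (fun x => z x * derive1 phi x).
    apply: measurable_funM => //.
    exact: measurable_funS (open_measurable oO) KO mz.
  have left_le : - (\int[mu]_(x in K) (z x * derive1 phi x)) >= -2.
    rewrite lerN2 (le_trans (ler_norm _))//.
    have bound : (`|\int[mu]_(x in K) (z x * derive1 phi x)%:E| <= 2%:E)%E.
      apply: (le_trans (le_abse_integral mu mK _)); last apply: le_trans intw.
        exact/measurable_EFinP.
      apply: ae_ge0_le_integral => //.
      - by apply: measurableT_comp => //; exact/measurable_EFinP.
      - by move=> x _; rewrite lee_fin (le_trans _ (phi'w x)).
      - apply/measurable_EFinP; apply: measurable_funTS.
        exact: continuous_measurable_fun.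
      - have := z1; apply: (@filterS _ _ (ae_filter_ringOfSetsType mu)).
        move=> x zx Kx; rewrite lee_fin normrM.
        rewrite (le_trans _ (phi'w x))// ler_piMl// zx//.
        exact: KO.
    (* Return from the extended reals: a finite value inherits the bound, and [fine] sends an
       infinite one to 0. *)
    rewrite /Rintegral; move: bound.
    by case: (integral _ _ _) => [r||]//=; rewrite normr0.
  have iphi : mu.-integrable K (EFin \o phi).
    by apply: continuous_compact_integrable => //; exact: continuous_subspaceT.
  (* The integrand is compared with a multiple of the indicator of the plateau [J], of length b - a
     - 4 d: on [J], phi >= 1 - 2 d and g <= -c; elsewhere in [K], g phi <= 0. *)
  have right_le : \int[mu]_(x in K) (g x * phi x) <=
      - (c * (1 - 2 * d)) * (b - a - 4 * d).
    set J : set R := `[a + 2 * d, b - 2 * d]%classic.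
    have mJ : measurable J by exact: measurable_itv.
    have JK : J `<=` K.
      move=> x; rewrite /J /K/= !in_itv/= => /andP[? ?].
      by apply/andP; split; lra.
    have iJ : mu.-integrable K (EFin \o \1_J).
      exact: integrableS (integrable_indic_itv _ _ _ _).
    have -> : - (c * (1 - 2 * d)) * (b - a - 4 * d) =
        \int[mu]_(x in K) (- (c * (1 - 2 * d)) * \1_J x).
      rewrite RintegralZl//.
      rewrite /Rintegral integral_indic// setIidl//; congr (_ * _).
      rewrite -[LHS]/(fine (b - a - 4 * d)%:E); congr fine.
      rewrite [RHS]lebesgue_measure_itv/= lte_fin ifT; last lra.
      by rewrite -EFinB; congr (_%:E); ring.
    apply: le_Rintegral => //.
    + have ig : mu.-integrable K (EFin \o g).
        apply/integrableP; split; last exact: lg.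
        apply/measurable_EFinP.
        exact: measurable_funS (open_measurable oO) KO mg.
      apply: (@integrableMl _ _ _ mu K mK (EFin \o g) phi) => //.
      have /compact_bounded[M [_ Mphi]] :=
        continuous_compact (continuous_subspaceT cphi) cK.
      by exists M; split; rewrite ?num_real// => ? ? ? ?; exact: Mphi.
    + exact: (@integrableZl _ _ _ mu K mK _ (EFin \o \1_J)).
    + move=> x Kx.
      have gx := gc _ (KO _ Kx).
      have phix := phi_ge0 x.
      rewrite indicE; have [Jx|nJx] := pselect (J x).
        rewrite mem_set// mulr1.
        have := phi_ge x; rewrite /J/= in_itv/= in Jx => /(_ Jx) ?.
        nra.
      rewrite memNset// mulr0; nra.
  move=> zge; rewrite zge in left_le.
  have := le_trans left_le right_le; lra.
rewrite leNgt; apply/negP => cL.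
have L0 : 0 < b - a by lra.
have c_gt0 : 0 < c by nra.
(* With L = b - a, expanding gives c (1 - 2 d)(L - 4 d) >= c L - k d. The choice of [d] below makes
   k d at most half of the excess c L - 2, while d <= L / 8 ensures 4 d < L. *)
set k := c * (4 + 2 * (b - a)).
have k0 : 0 < k by rewrite /k; nra.
pose d := Num.min ((b - a) / 8) ((c * (b - a) - 2) / (2 * k)).
have d0 : 0 < d by rewrite lt_min !divr_gt0//; lra.
have dL : d <= (b - a) / 8 by rewrite ge_min lexx.
have dk : d <= (c * (b - a) - 2) / (2 * k) by rewrite ge_min lexx orbT.
rewrite ler_pdivlMr in dk; last by rewrite mulr_gt0.
have := key d d0; rewrite /k in dk; nra.
Qed.

End NoSolution.

(** * Weak derivative of a function that is affine on each component *)

Section ZeroSolution.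
Context {R : realType}.
Local Notation mu := (@lebesgue_measure R).

Lemma Rintegral_zero_measure d (T : measurableType d)
    (m : {measure set T -> \bar R})    (A : set T) (h : T -> R) :
  (forall B, measurable B -> m B = 0%E) -> \int[m]_(x in A) h x = 0.
Proof.
move=> m0; rewrite /Rintegral (eq_measure_integral mzero).
  by rewrite integral_measure_zero.
by move=> B mB _; exact: m0.
Qed.

Lemma Rintegral_eq0 (A : set R) (h : R -> R) :
  (forall x, h x = 0) -> \int[mu]_(x in A) h x = 0.
Proof.
by move=> h0; rewrite /Rintegral integral0_eq// => x _; rewrite h0.
Qed.

Lemma bounded_set_finite_measure (A : set R) :
  bounded_set A -> measurable A -> (mu A < +oo)%E.
Proof.
move=> [M [_ AM]] mA.
apply: (@le_lt_trans _ _ (mu `[- (M + 1), M + 1])).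
  rewrite le_measure ?inE//.
  by move=> x Ax; rewrite /= in_itv/= -ler_norml; apply: AM Ax; rewrite ltrDl.
rewrite [ltLHS]lebesgue_measure_itv/=.
by case: ifP => _; rewrite ?ltry// -EFinB ltry.
Qed.

Lemma bounded_continuous_support (A K : set R) (h : R -> R) : continuous h ->
  compact K -> (forall x, ~ K x -> h x = 0) -> [bounded h x | x in A].
Proof.
move=> ch cK h0.
have /compact_bounded[M [Mr hM]] :=
  continuous_compact (continuous_subspaceT ch) cK.
exists (Num.max M 0); split; first by rewrite num_real.
move=> y; rewrite gt_max => /andP[My y0] x _ /=.
have [Kx|/h0 ->] := pselect (K x); last by rewrite normr0 ltW.
by apply: hM My _ _; exists x.
Qed.

(** If an endpoint of the n-th interval lay in the k-th one, the two would overlap next to that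
    endpoint, so disjointness would force k = n, although open intervals omit their endpoints.
    Consequently test functions vanish at these endpoints. *)
Lemma component_endpoints (I : set nat) (a b : nat -> R) n :
  (forall k, I k -> a k < b k) -> trivIset I (fun k => `]a k, b k[%classic) ->
  I n -> ~ (\bigcup_(k in I) `]a k, b k[%classic) (a n) /\
         ~ (\bigcup_(k in I) `]a k, b k[%classic) (b n).
Proof.
move=> ab tI In; have abn := ab n In.
split=> -[k Ik]; rewrite /= in_itv/= => /andP[lo hi].
- have kn : k = n.
    apply: (tI k n Ik In); exists ((a n + Num.min (b k) (b n)) / 2).
    have h1 : a n < Num.min (b k) (b n) by rewrite lt_min hi.
    have h2 : Num.min (b k) (b n) <= b k by rewrite ge_min lexx.
    have h3 : Num.min (b k) (b n) <= b n by rewrite ge_min lexx orbT.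
    by split; rewrite /= in_itv/=; apply/andP; split; lra.
  by move: lo; rewrite kn ltxx.
- have kn : k = n.
    apply: (tI k n Ik In); exists ((b n + Num.max (a k) (a n)) / 2).
    have h1 : Num.max (a k) (a n) < b n by rewrite gt_max lo.
    have h2 : a k <= Num.max (a k) (a n) by rewrite le_max lexx.
    have h3 : a n <= Num.max (a k) (a n) by rewrite le_max lexx orbT.
    by split; rewrite /= in_itv/=; apply/andP; split; lra.
  by move: hi; rewrite kn ltxx.
Qed.

(** By the product rule the integrand is the derivative of -c (x - m) phi, which vanishes at both
    ends. *)
Lemma integral_component_eq0 (a b c m : R) (phi : R -> R) : a < b ->
  smooth phi -> phi a = 0 -> phi b = 0 ->
  (\int[mu]_(x in `]a, b[)
    (- c * (x - m) * derive1 phi x + - c * phi x)%:E)%E = 0%E.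
Proof.
move=> ab sphi phia phib.
set h := fun x : R => - c * (x - m) * derive1 phi x + - c * phi x.
pose F (x : R) := - c * (x - m) * phi x.
have dF (x : R) : is_derive x 1 F (h x).
  have dphi := derivableP (sphi 0%N x).
  have daff : is_derive x (1 : R) (fun x => - c * (x - m)) (- c).
    have := is_deriveZ (- c)
      (is_deriveB (is_derive_id x 1) (is_derive_cst m x 1)).
    by move=> /is_derive_eq; apply; rewrite subr0 /GRing.scale/= mulr1.
  have := is_deriveM daff dphi.
  by move=> /is_derive_eq; apply; rewrite -derive1E /GRing.scale/= /h; ring.
have cF : continuous F.
  move=> x; apply/differentiable_continuous/derivable1_diffP.
  by have [] := dF x.
have ch : continuous h.
  move=> x; apply: cvgD; apply: cvgM.
  - apply: cvgM; first exact: cvg_cst.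
    by apply: cvgB; [exact: cvg_id|exact: cvg_cst].
  - exact: (@smooth_continuous _ phi 1%N).
  - exact: cvg_cst.
  - exact: (@smooth_continuous _ phi 0%N).
have mh : measurable_fun `]a, b[ h.
  by apply: measurable_funTS; exact: continuous_measurable_fun.
rewrite -(integral_itv_bndoo true false); last exact/measurable_EFinP.
rewrite (@continuous_FTC2 _ h F) //.
- by rewrite /F phia phib !mulr0 subee.
- exact: continuous_subspaceT.
- split=> [x _||]; first by have [] := dF x.
    exact: cvg_at_right_filter (cF _).
  exact: cvg_at_left_filter (cF _).
- by move=> x _; rewrite derive1E; have [_ ->] := dF x.
Qed.

(** Countable additivity reduces the identity to one component at a time. The bound [M] and the
    boundedness of [Omega] supply the integrability that this requires. *)
Lemma weak_derivative_piecewise_affine (Omega : set R) (I : set nat)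
    (a b m : nat -> R) (z : R -> R) (c M : R) :
  open Omega -> bounded_set Omega ->
  (forall n, I n -> a n < b n) ->
  trivIset I (fun n => `]a n, b n[%classic) ->
  Omega = \bigcup_(n in I) `]a n, b n[%classic ->
  (forall n x, I n -> a n < x < b n -> z x = - c * (x - m n)) ->
  (forall x, Omega x -> `|z x| <= M) ->
  measurable_fun Omega z /\ weak_derivative Omega z (fun=> - c).
Proof.
move=> oO bO ab tI OE zE zM.
have mO : measurable Omega by exact: open_measurable.
have Ofin : (mu Omega < +oo)%E by exact: bounded_set_finite_measure.
(* Padding with empty sets makes the family indexed by all naturals, so that the integral over
   [Omega] becomes a series. *)
pose F n := if n \in I then `]a n, b n[%classic else set0.
have OF : Omega = \bigcup_n F n by rewrite OE bigcup_mkcond.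
have mF n : measurable (F n) by rewrite /F; case: ifP.
have tF : trivIset setT F by rewrite /F -trivIset_mkcond.
have mz : measurable_fun Omega z.
  rewrite OF; apply/measurable_fun_bigcup => // n; rewrite /F.
  case: ifPn => [|_]; last exact: measurable_fun_set0.
  rewrite inE => In.
  apply: (@eq_measurable_fun _ _ _ _ _ (fun x : R => - c * (x - m n))) => [x|].
    by rewrite inE/= in_itv/= => /(zE _ _ In).
  apply: measurable_funM => //; exact: measurable_funB.
have bz : [bounded z x | x in Omega].
  exists M; split; first by rewrite num_real.
  by move=> y My x Ox /=; rewrite (le_trans (zM x Ox))// ltW.
have iz : mu.-integrable Omega (EFin \o z).
  exact: measurable_bounded_integrable.
have ic : mu.-integrable Omega (EFin \o (fun=> - c)).
  apply: measurable_bounded_integrable => //.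
  by exists `|c|; split; rewrite ?num_real// => y cy x _; rewrite normrN ltW.
split=> //; split; try exact: open_integrable_locally.
move=> phi [sphi cK KO].
set K := closure _ in cK KO.
have phi0 x : ~ K x -> phi x = 0.
  move=> nKx; apply/eqP; apply: contra_notT nKx => phix.
  exact: subset_closure.
have phi'0 x : ~ K x -> derive1 phi x = 0.
  move=> nKx; apply: (@derive1_locally_eq0 _ _ (~` K)) => //.
  by apply: closed_openC; exact: closed_closure.
have cphi : continuous phi by exact: (@smooth_continuous _ phi 0%N).
have cphi' : continuous (derive1 phi) by exact: (@smooth_continuous _ phi 1%N).
have mphi A : measurable_fun A phi.
  by apply: measurable_funTS; exact: continuous_measurable_fun.
have mphi' A : measurable_fun A (derive1 phi).
  by apply: measurable_funTS; exact: continuous_measurable_fun.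
have izphi' : mu.-integrable Omega (EFin \o (fun x => z x * derive1 phi x)).
  apply: (@integrableMl _ _ _ mu _ mO (EFin \o z) (derive1 phi) iz).
    exact: mphi'.
  exact: (bounded_continuous_support _ cphi' cK phi'0).
have icphi : mu.-integrable Omega (EFin \o (fun x => - c * phi x)).
  apply: (@integrableMl _ _ _ mu _ mO (EFin \o (fun=> - c)) phi ic).
    exact: mphi.
  exact: (bounded_continuous_support _ cphi cK phi0).
(* Both sides are gathered into one integral, that of z phi' - c phi, which has to vanish. *)
apply/eqP; rewrite eq_sym -addr_eq0 addrC -RintegralD//; apply/eqP.
rewrite /Rintegral OF integral_bigcup//; last first.
  by rewrite -OF; exact: (@integrableD _ _ _ mu _ mO _ _ izphi' icphi).
rewrite eseries0// => n _ _; rewrite /F.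
case: ifPn => [|_]; last by rewrite integral_set0.
rewrite inE => In; have [nOa nOb] := component_endpoints ab tI In.
rewrite -[RHS](@integral_component_eq0 (a n) (b n) c (m n) phi) ?ab//.
- apply: eq_integral => x; rewrite inE/= in_itv/= => xab.
  by rewrite (zE n).
- by apply: phi0 => /KO; rewrite OE.
- by apply: phi0 => /KO; rewrite OE.
Qed.

End ZeroSolution.

(** * The zero measure, traces of affine functions, and the trivial solution *)

Section ZeroData.
Context {R : realType}.
Local Notation mu := (@lebesgue_measure R).
Local Notation czeroR := (czero : {charge set (measurableTypeR R) -> \bar R}).

Lemma jordan_pos_czero P N (PN : hahn_decomposition czeroR P N) A :
  jordan_pos PN A = 0%E.
Proof. by rewrite jordan_posE cjordan_posE /crestr0; case: ifP. Qed.

Lemma jordan_neg_czero P N (PN : hahn_decomposition czeroR P N) A :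
  jordan_neg PN A = 0%E.
Proof.
by rewrite jordan_negE cjordan_negE /crestr0; case: ifP => _; rewrite oppe0.
Qed.

Lemma right_trace_cst (t a : R) : right_trace (fun=> t) a t.
Proof.
by move=> e e0; exists 1 => //; apply: aeW => x _; rewrite subrr normr0 ltW.
Qed.

Lemma left_trace_cst (t b : R) : left_trace (fun=> t) b t.
Proof.
by move=> e e0; exists 1 => //; apply: aeW => x _; rewrite subrr normr0 ltW.
Qed.

Lemma right_trace_affine (z : R -> R) (a b c m : R) : a < b ->
  (forall x, a < x < b -> z x = c * (x - m)) -> right_trace z a (c * (a - m)).
Proof.
move=> ab zE e e0.
(* Adding 1 keeps the denominator of the radius positive when c = 0. *)
have c1 : 0 < `|c| + 1 by rewrite ltr_wpDl.
exists (Num.min (b - a) (e / (`|c| + 1))).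
  by rewrite lt_min subr_gt0 ab divr_gt0.
apply: aeW => x /andP[ax]; rewrite -ltrBlDl lt_min => /andP[xb xe].
rewrite zE; last by rewrite ax /=; lra.
rewrite -mulrBr normrM (_ : x - m - (a - m) = x - a); last by ring.
rewrite (gtr0_norm (_ : 0 < x - a)) ?subr_gt0//.
move: xe; rewrite ltr_pdivlMr// => xe.
have := normr_ge0 c; nra.
Qed.

Lemma left_trace_affine (z : R -> R) (a b c m : R) : a < b ->
  (forall x, a < x < b -> z x = c * (x - m)) -> left_trace z b (c * (b - m)).
Proof.
move=> ab zE e e0.
have c1 : 0 < `|c| + 1 by rewrite ltr_wpDl.
exists (Num.min (b - a) (e / (`|c| + 1))).
  by rewrite lt_min subr_gt0 ab divr_gt0.
apply: aeW => x /andP[]; rewrite ltrBlDr -ltrBlDl lt_min => /andP[xa xe] xb.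
rewrite zE; last by rewrite xb andbT; lra.
rewrite -mulrBr normrM (_ : x - m - (b - m) = - (b - x)); last by ring.
rewrite normrN (gtr0_norm (_ : 0 < b - x)) ?subr_gt0//.
move: xe; rewrite ltr_pdivlMr// => xe.
have := normr_ge0 c; nra.
Qed.

(** For u = 0 the pairing and the variation of Du both vanish, and sign(0) = [-1, 1]. What remains
    is a [z] of slope -l f(0) on each component, bounded by 1 in absolute value; centring it at the
    midpoint gives |z| <= l f(0) L / 2. *)
Lemma zero_is_solution (Omega : set R) (I : set nat) (a b : nat -> R) (L : R)
    (f : R -> R) (l : R) :
  bounded_set Omega -> open Omega ->
  (forall n, I n -> a n < b n) ->
  trivIset I (fun n => `]a n, b n[%classic) ->
  Omega = \bigcup_(n in I) `]a n, b n[%classic ->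
  (forall n, I n -> b n - a n <= L) ->
  0 <= f 0 -> 0 <= l -> l * f 0 * L <= 2 ->
  is_solution Omega I a b f l (fun=> 0).
Proof.
move=> bO oO ab tI OE bL f0 l0 cL.
have mO : measurable Omega by exact: open_measurable.
have Ofin : (mu Omega < +oo)%E by exact: bounded_set_finite_measure.
split=> //.
  split; first exact: measurable_cst.
  exists (f 0 * fine (mu Omega)) => k k0.
  have -> : (f 0 * fine (mu Omega))%:E = ((f 0)%:E * mu Omega)%E.
    by rewrite EFinM fineK// ge0_fin_numE.
  (* The level set is empty once k >= f(0); below that, k times its measure is at most f(0) times
     the measure of [Omega]. *)
  have [kf|fk] := ltP k (f 0).
    apply: lee_pmul => //; [exact: (ltW k0)|by rewrite lee_fin ltW|].
    apply: le_measure; rewrite ?inE//.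
    apply: measurableI => //.
    have [k1|k1] := pselect (k < `|f 0|).
      by rewrite (_ : [set _ | _] = setT)//; apply/seteqP; split.
    by rewrite (_ : [set _ | _] = set0)//; apply/seteqP; split.
  rewrite (_ : Omega `&` _ = set0) ?measure0 ?mule0 ?mule_ge0//.
  by apply/seteqP; split => // x [_] /=; rewrite ger0_norm// ltNge fk.
have [P [N PN]] := Hahn_decomposition czeroR.
pose c := l * f 0.
have c0 : 0 <= c by exact: mulr_ge0.
(* The index of the component containing [x], unique by disjointness; the default 0 is taken only
   outside [Omega]. *)
pose comp x := xget 0%N [set n | I n /\ a n < x < b n].
pose m n := (a n + b n) / 2.
pose z (x : R) := - c * (x - m (comp x)).
have compE n x : I n -> a n < x < b n -> comp x = n.
  move=> In xab; rewrite /comp; case: xgetP => [k _ [Ik xk]|/(_ n)[]//].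
  by apply: (tI k n Ik In); exists x; split; rewrite /= in_itv.
have zE n x : I n -> a n < x < b n -> z x = - c * (x - m n).
  by move=> In xab; rewrite /z (compE n).
have z1 x : Omega x -> `|z x| <= 1.
  rewrite OE => -[n In]; rewrite /= in_itv/= => xab; rewrite (zE n)//.
  have bLn := bL n In; move: xab => /andP[ax xb].
  rewrite /m ler_norml; apply/andP; split; rewrite -/c in cL; nra.
have [mz wz] := weak_derivative_piecewise_affine oO bO ab tI OE zE z1.
exists czero, P, N, PN, z => dz; split => //.
- split.
  + exact: integrable0.
  + by [].
  + move=> phi _.
    rewrite Rintegral_eq0; last by move=> x; rewrite mul0r.
    rewrite !Rintegral_zero_measure ?subr0 ?oppr0// => B _.
      exact: jordan_neg_czero.
    exact: jordan_pos_czero.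
- by split=> //; exact: aeW.
- move=> phi _; rewrite /pairing.
  rewrite Rintegral_eq0; last by move=> x; rewrite !mul0r.
  rewrite Rintegral_eq0; last by move=> x; rewrite !mul0r.
  rewrite Rintegral_zero_measure ?subr0 ?oppr0// => B _.
  (* The variation unfolds to the sum of the two Jordan parts, both zero here. *)
  rewrite -[LHS]/(jordan_pos PN B + jordan_neg PN B)%E.
  by rewrite jordan_pos_czero jordan_neg_czero adde0.
- move=> n In; have bLn := bL n In; have abn := ab n In.
  rewrite -/c in cL; split.
  + exists 0, (- c * (a n - m n)); split.
    * exact: right_trace_cst.
    * by apply: (right_trace_affine abn) => x; exact: zE.
    (* The trace of [z] at a_n is c (b_n - a_n) / 2, which lies in [0, 1] because c L <= 2; at b_n
       it is the opposite value. *)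
    * rewrite /multisign oppr0 eqxx /= in_itv/= /m; apply/andP; split; nra.
  + exists 0, (- c * (b n - m n)); split.
    * exact: left_trace_cst.
    * by apply: (left_trace_affine abn) => x; exact: zE.
    * rewrite /multisign oppr0 eqxx /= in_itv/= /m; apply/andP; split; nra.
Qed.

End ZeroData.

Theorem theorem3p1 (R : realType) (Omega : set R) (I : set nat)
    (a b : nat -> R) (L : R) (f : R -> R) (lambda : R)
    (Omega_neq0 : Omega !=set0)
    (Omega_bounded : bounded_set Omega)
    (Omega_open : open Omega)
    (I_index : I = [set: nat] \/ exists k : nat, I = `I_k)
    (ab_lt : forall n, I n -> a n < b n)
    (ab_disj : trivIset I (fun n => `]a n, b n[%classic))
    (OmegaE : Omega = \bigcup_(n in I) `]a n, b n[%classic)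
    (L_attained : exists2 n, I n & L = b n - a n)
    (L_ub : forall n, I n -> b n - a n <= L)
    (f_ge0 : forall s, 0 <= s -> 0 <= f s)
    (f_incr : forall s t, 0 <= s -> s < t -> f s < f t)
    (f_cont : {within `[0, +oo[%classic, continuous f})
    (f_lim : f s @[s --> +oo] --> +oo)
    (f0_gt0 : 0 < f 0)
    (lambda_gt0 : 0 < lambda) :
  (2 / (L * f 0) < lambda ->
     ~ exists u : R -> R, is_solution Omega I a b f lambda u) /\
  (lambda <= 2 / (L * f 0) ->
     is_minimal_solution Omega I a b f lambda (fun=> 0)).
Proof.
have [n In LE] := L_attained.
have L_gt0 : 0 < L by rewrite LE subr_gt0 ab_lt.
split.
  rewrite ltr_pdivrMr ?mulr_gt0// => lt2.
  move=> [u [u_ge0 _ [Du [P [N [PN [z [_ [_ z1] wz _ _]]]]]]]].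
  (* Here [n] indexes a component of maximal length. Since u >= 0 and f increases, -z' = lambda f(u)
     is at least lambda f(0) there. *)
  have : lambda * f 0 * (b n - a n) <= 2.
    apply: (weak_derivative_le_length _ (ab_lt _ In) _ wz z1) => [||x Ox].
    - by rewrite mulr_ge0// ltW.
    - by rewrite OmegaE => x xab; exists n.
    - rewrite lerN2; apply: ler_wpM2l; first exact: ltW.
      have := u_ge0 x Ox; rewrite le_eqVlt => /predU1P[<-//|ux].
      by rewrite ltW// f_incr.
  by rewrite -LE leNgt -mulrA (mulrC (f 0)) lt2.
rewrite ler_pdivlMr ?mulr_gt0// => le2.
split; last by move=> v [v_ge0 _ _]; exact: aeW.
apply: (@zero_is_solution _ _ _ _ _ L) => //; try exact: ltW.
by rewrite -mulrA (mulrC (f 0)).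
Qed.
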